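(* Let $\mathbb B=\{q\in\mathbb H:|q|<1\}$ and let $f(q)=\sum_{n=0}^\infty q^na_n$ ($a_n\in\mathbb H$) be a slice regular function on $\mathbb B$. Suppose $A:=\sup_{q\in\mathbb B}\mathrm{Re}\,f(q)<+\infty$. Then $$|a_n|\le 2\big(A-\mathrm{Re}\,f(0)\big)\qquad\forall\, n\in\mathbb N=\{1,2,\dots\};$$ $$|f(q)-f(0)|\le\frac{2r}{1-r}\big(A-\mathrm{Re}\,f(0)\big)\qquad\forall\,|q|\le r<1;$$ $$\mathrm{Re}\,f(q)\le\frac{2r}{1+r}A+\frac{1-r}{1+r}\mathrm{Re}\,f(0)\qquad\forall\,|q|\le r<1;$$ $$|f^{(n)}(q)|\le\frac{2\,n!}{(1-r)^{n+1}}\big(A-\mathrm{Re}\,f(0)\big)\qquad\forall\,|q|\le r<1,\ n\in\mathbb N.$$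
   Context: $\mathbb H$ denotes the quaternions; $\mathrm{Re}\,q$ and $|q|$ are real part and modulus. $\mathbb S=\{q\in\mathbb H:q^2=-1\}$ and $\mathbb C_I=\mathbb R+I\mathbb R$ for $I\in\mathbb S$. A function $f$ on a domain $\Omega\subseteq\mathbb H$ is slice regular if for every $I\in\mathbb S$ its restriction $f_I$ to $\Omega\cap\mathbb C_I$ has continuous partial derivatives and satisfies $\frac12\big(\frac{\partial}{\partial x}+I\frac{\partial}{\partial y}\big)f_I(x+yI)=0$; on a ball centred at $0$ such functions are exactly convergent power series $\sum q^na_n$ with right coefficients. The slice derivative of $f$ at $x+yI$ is $\frac12\big(\frac{\partial}{\partial x}-I\frac{\partial}{\partial y}\big)f_I(x+yI)$ (which equals $\partial f/\partial x$), and $f^{(n)}$ denotes the $n$-th iterated slice derivative, so that $f^{(n)}(q)=\sum_{m\ge n}m(m-1)\cdots(m-n+1)q^{m-n}a_m$. *)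

(* Defs.v *)
From mathcomp Require Import all_boot all_order all_algebra.
From mathcomp Require Import all_classical all_reals all_analysis.
Set Implicit Arguments. Unset Strict Implicit. Unset Printing Implicit Defensive.
Import Order.TTheory GRing.Theory Num.Theory numFieldNormedType.Exports.
Local Open Scope classical_set_scope.
Local Open Scope ring_scope.

Record quat (R : realType) := Quat { qre : R; qi : R; qj : R; qk : R }.

Section Quat.
Variable R : realType.

Definition qadd (p q : quat R) : quat R :=
  Quat (qre p + qre q) (qi p + qi q) (qj p + qj q) (qk p + qk q).
Definition qopp (p : quat R) : quat R := Quat (- qre p) (- qi p) (- qj p) (- qk p).
Definition qsub (p q : quat R) : quat R := qadd p (qopp q).
Definition qzero : quat R := Quat 0 0 0 0.
Definition qone : quat R := Quat 1 0 0 0.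
Definition qmul (p q : quat R) : quat R :=
  Quat (qre p * qre q - qi p * qi q - qj p * qj q - qk p * qk q)
       (qre p * qi q + qi p * qre q + qj p * qk q - qk p * qj q)
       (qre p * qj q - qi p * qk q + qj p * qre q + qk p * qi q)
       (qre p * qk q + qi p * qj q - qj p * qi q + qk p * qre q).
Definition qscale (c : R) (p : quat R) : quat R :=
  Quat (c * qre p) (c * qi p) (c * qj p) (c * qk p).
Definition qpow (q : quat R) (n : nat) : quat R := iter n (qmul q) qone.
Definition qnorm (q : quat R) : R :=
  Num.sqrt (qre q ^+ 2 + qi q ^+ 2 + qj q ^+ 2 + qk q ^+ 2).

Definition qcvg (u : nat -> quat R) (l : quat R) : Prop :=
  [/\ (fun N => qre (u N)) @ \oo --> qre l,
      (fun N => qi (u N)) @ \oo --> qi l,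
      (fun N => qj (u N)) @ \oo --> qj l &
      (fun N => qk (u N)) @ \oo --> qk l].
(* its limit (meaningful when it converges) *)
Definition qlim (u : nat -> quat R) : quat R :=
  Quat (limn (fun N => qre (u N))) (limn (fun N => qi (u N)))
       (limn (fun N => qj (u N))) (limn (fun N => qk (u N))).

Definition qpsum (a : nat -> quat R) (q : quat R) (N : nat) : quat R :=
  foldr qadd qzero [seq qmul (qpow q m) (a m) | m <- iota 0 N].

Definition qseries (a : nat -> quat R) (q : quat R) : quat R := qlim (qpsum a q).

(* n-th slice derivative of f = sum q^m a_m:
   f^(n)(q) = sum_{m>=n} m(m-1)...(m-n+1) q^(m-n) a_m *)
Definition sderiv_coef (a : nat -> quat R) (n : nat) : nat -> quat R :=
  fun k => qscale ((k + n) ^_ n)%:R (a (k + n)).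
Definition sderiv (a : nat -> quat R) (n : nat) (q : quat R) : quat R :=
  qseries (sderiv_coef a n) q.

End Quat.

(* Main.v *)
Require Import Defs.
From mathcomp Require Import all_boot all_order all_algebra.
From mathcomp Require Import all_classical all_reals all_analysis.
From mathcomp Require Import separable cyclic cyclotomic complex ring lra zify.
Import Order.TTheory GRing.Theory Num.Theory numFieldNormedType.Exports.
Import Normc.
Set Implicit Arguments.
Unset Strict Implicit.
Local Open Scope ring_scope.
Local Open Scope complex_scope.
Local Notation Re := complex.Re.
Local Notation Im := complex.Im.

(** On the slice of an imaginary unit [I], [Re (q^n a)] is the real part of
    [alpha z^n], where [z] is the complex coordinate of [q] and
    [alpha = Re a + i <I, Im a>].  Hence [Re f] restricted to a slice is the
    real part of a complex power series, and the claims about [Re f] become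
    inequalities for a nonnegative harmonic function [A - Re f] on the disc.
    They follow by pairing it on a circle of radius [rho < 1] with a
    nonnegative trigonometric polynomial: [1 - Re (x z^n)] bounds the [n]-th
    coefficient, and the truncated Poisson kernel gives the Harnack
    inequality.  After truncating the series, the pairing is a finite average
    over roots of unity, so no integral is needed; the truncation error is
    geometric, and finally [rho] tends to [1].  The coefficient bound for
    [a_n] is read on the slice that contains [a_n], where [|alpha| = |a_n|].
    The remaining two estimates are sums of the coefficient bounds. *)

(** * Roots of unity and their power sums *)

Lemma closed_prim_root_exists (C : numClosedFieldType) (n : nat) :
  (0 < n)%N -> exists z : C, n.-primitive_root z.
Proof.
move=> n_gt0; have [r rE] := closed_field_poly_normal ('X^n - 1 : {poly C}).
rewrite (monicP (monicXnsubC 1 n_gt0)) scale1r in rE.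
(* In characteristic 0 the polynomial [X^n - 1] is separable, so it has [n] distinct roots. *)
have uniq_r : uniq r.
  by rewrite -separable_prod_XsubC -rE separable_Xn_sub_1 // pnatr_eq0 -lt0n.
have size_r : size r = n.
  by apply: succn_inj; rewrite -(size_prod_XsubC r id) -rE size_XnsubC.
suff /hasP[z _ pz] : has n.-primitive_root r by exists z.
apply: has_prim_root; rewrite ?size_r //.
by apply/allP => z; rewrite -root_prod_XsubC -rE.
Qed.

(** If [n] does not divide [j], then [w ^+ j] differs from 1 and the geometric sum telescopes to
    [(w ^+ j) ^+ n - 1 = 0]. *)
Lemma sum_prim_root_exp (F : fieldType) (n : nat) (w : F) (j : nat) :
  n.-primitive_root w ->
  \sum_(k < n) w ^+ (k * j) = if (n %| j)%N then n%:R else 0.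
Proof.
move=> pw; under eq_bigr => k _ do rewrite mulnC exprM.
case: ifPn => [/eqP nj|nj].
  under eq_bigr => k _ do rewrite -(prim_expr_mod pw) nj expr0 expr1n.
  by rewrite sumr_const card_ord.
have wj1 : w ^+ j - 1 != 0 by rewrite subr_eq0 -(prim_order_dvd pw).
apply: (mulfI wj1); rewrite -subrX1 mulr0 -exprM mulnC exprM.
by rewrite (prim_expr_order pw) expr1n subrr.
Qed.

(** * Modulus and real part of complex numbers *)

Section Modulus.
Variable R : rcfType.
Implicit Types (z w : R[i]) (x : R).

Lemma normc_ge0 z : 0 <= normc z.
Proof. by case: z => a b; apply: sqrtr_ge0. Qed.

Lemma sqr_normcE z : normc z ^+ 2 = Re z ^+ 2 + Im z ^+ 2.
Proof. by case: z => a b /=; rewrite sqr_sqrtr // addr_ge0 ?sqr_ge0. Qed.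

Lemma normcX z n : normc (z ^+ n) = normc z ^+ n.
Proof. by elim: n => [|n IH]; rewrite ?normc1 // !exprS normcM IH. Qed.

Lemma normc_conj z : normc z^* = normc z.
Proof. by case: z => a b /=; rewrite sqrrN. Qed.

Lemma normc_real x : normc x%:C = `|x|.
Proof. by rewrite /= expr0n /= addr0 sqrtr_sqr. Qed.

Lemma norm_Re_le_normc z : `|Re z| <= normc z.
Proof.
case: z => a b /=; rewrite -[leLHS]sqrtr_sqr ler_wsqrtr //.
by rewrite lerDl sqr_ge0.
Qed.

Lemma ReD z w : Re (z + w) = Re z + Re w.
Proof. by case: z w => [a b] [c d]. Qed.

Lemma ReN z : Re (- z) = - Re z.
Proof. by case: z. Qed.

Lemma ReZ x z : Re (x%:C * z) = x * Re z.
Proof. by case: z => a b /=; rewrite mul0r subr0. Qed.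

Lemma Re_sum (I : Type) (r : seq I) (P : pred I) (F : I -> R[i]) :
  Re (\sum_(i <- r | P i) F i) = \sum_(i <- r | P i) Re (F i).
Proof. exact: (big_morph _ ReD). Qed.

Lemma mulJc z : z^* * z = (normc z ^+ 2)%:C.
Proof. by rewrite sqr_normcE; case: z => a b; simpc => /=; congr (_ +i* _); ring. Qed.

Lemma ReM_Re z w : Re z * Re w *+ 2 = Re (z * w^*%C + z * w).
Proof. by case: z w => [a b] [c d] /=; ring. Qed.

End Modulus.

(** * Discrete averaging over the unit circle *)

Section CirclePairing.
Variable R : rcfType.

(** Twice the product of the two real parts is [Re (P a * conj (P b) + P a * P b)]. Averaged over
    roots of unity, the first summand leaves the diagonal sum and the second leaves [a 0 * b 0]. *)
Lemma circle_pairing_ge0 (M : nat) (a b : nat -> R[i]) :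
  (forall z, normc z = 1 -> 0 <= Re (\sum_(n < M.+1) a n * z ^+ n)) ->
  (forall z, normc z = 1 -> 0 <= Re (\sum_(n < M.+1) b n * z ^+ n)) ->
  0 <= Re (\sum_(n < M.+1) a n * (b n)^*%C + a 0 * b 0).
Proof.
(* This order exceeds every [n + m] with [n, m <= M], so distinct frequencies do not alias. *)
move=> Pa Pb; pose N := (M.+1 + M.+1)%N.
have [w pw] : exists z : R[i], N.-primitive_root z.
  exact: closed_prim_root_exists.
have wN : w ^+ N = 1 by apply: prim_expr_order.
have w1 : normc w = 1.
  apply/eqP; rewrite -(@pexpr_eq1 _ _ N) ?normc_ge0 //.
  by rewrite -normcX wN normc1.
have wk1 k : normc (w ^+ k) = 1 by rewrite normcX w1 expr1n.
(* Conjugation inverts on the circle; [N - m] stands for the exponent [- m]. *)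
have wJ k m : (m <= N)%N -> ((w ^+ k)^*%C) ^+ m = w ^+ (k * (N - m)).
  move=> mN; have wkm : w ^+ k ^+ m != 0.
    by rewrite !expf_eq0 (prim_root_eq0 pw) /= !andbF.
  apply: (mulIf wkm); rewrite -exprMn mulJc wk1 !expr1n.
  by rewrite exprM -exprD subnK // -exprM mulnC exprM wN expr1n.
pose P (c : nat -> R[i]) z := \sum_(n < M.+1) c n * z ^+ n.
have sumPP : \sum_(k < N) P a (w ^+ k) * P b (w ^+ k) = N%:R * (a 0 * b 0).
  transitivity (\sum_(n < M.+1) \sum_(m < M.+1)
      a n * b m * \sum_(k < N) w ^+ (k * (n + m))).
    under eq_bigr => k _.
      rewrite /P mulr_suml; under eq_bigr => n _ do rewrite mulr_sumr.
      over.
    rewrite exchange_big /=; apply: eq_bigr => n _.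
    rewrite exchange_big /=; apply: eq_bigr => m _.
    rewrite mulr_sumr; apply: eq_bigr => k _.
    by rewrite mulnDr exprD !exprM; ring.
  rewrite big_ord_recl big_ord_recl /= sum_prim_root_exp // dvdn0.
  rewrite big1 ?addr0 => [|m _].
    rewrite big1 ?addr0 => [|n _]; first by rewrite mulrC.
    apply: big1 => m _; rewrite sum_prim_root_exp // gtnNdvd ?mulr0 //.
    by move: (ltn_ord n) (ltn_ord m); rewrite /N /bump /=; lia.
  rewrite sum_prim_root_exp // gtnNdvd ?mulr0 //.
  by move: (ltn_ord m); rewrite /N /bump /=; lia.
have sumPJ : \sum_(k < N) P a (w ^+ k) * (P b (w ^+ k))^*%C =
    N%:R * \sum_(n < M.+1) a n * (b n)^*%C.
  transitivity (\sum_(n < M.+1) \sum_(m < M.+1)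
      a n * (b m)^*%C * \sum_(k < N) w ^+ (k * (n + (N - m)))).
    under eq_bigr => k _.
      rewrite /P mulr_suml; under eq_bigr => n _ do rewrite rmorph_sum mulr_sumr.
      over.
    rewrite exchange_big /=; apply: eq_bigr => n _.
    rewrite exchange_big /=; apply: eq_bigr => m _.
    rewrite mulr_sumr; apply: eq_bigr => k _.
    rewrite rmorphM rmorphXn /= wJ ?(leq_trans (ltnW (ltn_ord m))) ?leq_addr //.
    by rewrite mulnDr exprD !exprM; ring.
  rewrite mulr_sumr; apply: eq_bigr => n _.
  rewrite (bigD1 n) //= sum_prim_root_exp // subnKC; last first.
    by rewrite (leq_trans (ltnW (ltn_ord n))) ?leq_addr.
  rewrite dvdnn big1 ?addr0 => [|m mn]; first by rewrite mulrC.
  rewrite sum_prim_root_exp //; case: ifP => [|_]; last by rewrite mulr0.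
  (* Since [n + (N - m)] lies strictly between 0 and [2 N], it can only be [N] itself, which forces
     [n = m]. *)
  case/dvdnP => q Eq; case/negP: mn; apply/eqP/val_inj => /=.
  move: Eq (ltn_ord n) (ltn_ord m); rewrite /N.
  by case: q => [|[|q]]; nia.
have : 0 <= \sum_(k < N) (Re (P a (w ^+ k)) * Re (P b (w ^+ k))) *+ 2.
  by apply: sumr_ge0 => k _; rewrite mulrn_wge0 // mulr_ge0 ?Pa ?Pb.
under eq_bigr => k _ do rewrite ReM_Re.
rewrite -Re_sum big_split /= sumPP sumPJ -mulrDr.
have -> : N%:R = (N%:R)%:C :> R[i] by rewrite rmorph_nat.
by rewrite ReZ pmulr_rge0 // ltr0n.
Qed.
End CirclePairing.

(** * Coefficient bound and Harnack inequality for polynomials *)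

Section FiniteHarnack.
Variable R : rcfType.
Implicit Types (a b : nat -> R[i]) (B : R).

(** The coefficients of [B - \sum_n a n * z ^+ n], the side of the pairing that is nonnegative by
    the bound on the real part. *)
Definition gap_coef a B : nat -> R[i] :=
  fun n => (if n == 0%N then B%:C else 0) - a n.

Lemma mulc_phaseJ (z : R[i]) :
  z * (z * ((normc z)^-1)%:C)^*%C = (normc z)%:C.
Proof.
have -> k : z * (z * k%:C)^*%C = ((Re z ^+ 2 + Im z ^+ 2) * k)%:C.
  by case: z => p q; simpc => /=; congr (_ +i* _); ring.
rewrite -sqr_normcE; have [->|n0] := eqVneq (normc z) 0.
  by rewrite expr0n mul0r.
by rewrite expr2 mulfK.
Qed.

Lemma gap_coef0 a B : gap_coef a B 0 = B%:C - a 0.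
Proof. by []. Qed.

Lemma gap_coefS a B n : gap_coef a B n.+1 = - a n.+1.
Proof. by rewrite /gap_coef sub0r. Qed.

Lemma gap_coef_ge0 M a B :
  (forall z, normc z = 1 -> Re (\sum_(n < M.+1) a n * z ^+ n) <= B) ->
  forall z, normc z = 1 ->
  0 <= Re (\sum_(n < M.+1) gap_coef a B n * z ^+ n).
Proof.
move=> aB z /aB h; under eq_bigr => n _ do rewrite mulrBl.
rewrite sumrB big_ord_recl /= expr0 mulr1 big1 => [|n _]; last by rewrite mul0r.
by rewrite addr0 ReD ReN subr_ge0.
Qed.

(** Pairing the gap with [1 + x z^n], where [x] is the phase of [a n], counts the constant term
    twice and gives [2 (B - Re (a 0)) - |a n| >= 0]. *)
Lemma finite_coef_le M a B (n : nat) :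
  (0 < n <= M)%N ->
  (forall z, normc z = 1 -> Re (\sum_(n < M.+1) a n * z ^+ n) <= B) ->
  normc (a n) <= 2 * (B - Re (a 0)).
Proof.
case: n => // m /= mM aB.
(* Since the inverse of 0 is 0, [x = 0] when the coefficient vanishes; hence [|x| <= 1] in every
   case. *)
pose x := a m.+1 * ((normc (a m.+1))^-1)%:C.
pose b k : R[i] := if k == 0%N then 1 else if k == m.+1 then x else 0.
have b_0 : b 0 = 1 by [].
have b_m : b m.+1 = x by rewrite /b /= eqxx.
have sum_b (G : nat -> R[i]) : (forall k, b k = 0 -> G k = 0) ->
    \sum_(k < M.+1) G k = G 0 + G m.+1.
  move=> bG; rewrite big_ord_recl; congr (_ + _).
  rewrite (bigD1 (Ordinal mM)) //= big1 ?addr0 // => k km.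
  by apply: bG; move: km; rewrite -val_eqE /b /bump /= add1n eqSS => /negPf ->.
have x1 : normc x <= 1.
  rewrite /x normcM normc_real ger0_norm ?invr_ge0 ?normc_ge0 //.
  by have [->|n0] := eqVneq (normc (a m.+1)) 0; rewrite ?mul0r ?mulfV.
have bge0 z : normc z = 1 -> 0 <= Re (\sum_(k < M.+1) b k * z ^+ k).
  move=> z1; rewrite (sum_b (fun k => b k * z ^+ k)) => [|k ->]; last by rewrite mul0r.
  rewrite /b /= eqxx mul1r expr0 ReD /= -lerBlDl sub0r.
  have := norm_Re_le_normc (x * z ^+ m.+1).
  rewrite normcM normcX z1 expr1n mulr1 ler_norml => /andP[h _].
  by apply: le_trans h; rewrite lerN2.
have := circle_pairing_ge0 (gap_coef_ge0 aB) bge0.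
rewrite (sum_b (fun k => gap_coef a B k * (b k)^*%C)) => [|k ->]; last first.
  by rewrite conjc0 mulr0.
rewrite gap_coef0 gap_coefS b_0 b_m conjc1 !mulr1 /x.
rewrite mulNr mulc_phaseJ !ReD !ReN /=.
lra.
Qed.

(** With [r = |w|], the right side equals [(1 - r^2) / |1 - w|^2], and [|1 - w| <= 1 + r]. *)
Lemma poisson_kernel_ge (w : R[i]) : normc w < 1 ->
  (1 - normc w) / (1 + normc w) <= Re ((1 + w) / (1 - w)).
Proof.
move=> w1; have := sqr_normcE w; have := norm_Re_le_normc w.
have := normc_ge0 w; move: w1; set r := normc w.
case: {1 2 3 4 5}w => x y /= r1 r0.
rewrite ler_norml => /andP[xr xr'] rE.
set D := (1 - x) ^+ 2 + _.
have DE : D = 1 - 2 * x + r ^+ 2 by rewrite rE /D; ring.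
have D0 : 0 < D by rewrite DE; nra.
have -> : (1 + x) * ((1 - x) / D) - (0 + y) * - ((0 - y) / D) = (1 - r ^+ 2) / D.
  by rewrite rE; field; rewrite gt_eqF.
rewrite ler_pdivrMr; last lra.
rewrite mulrAC ler_pdivlMr // DE; nra.
Qed.

Lemma normc_geometric_tail (w : R[i]) M : normc w < 1 ->
  normc (w ^+ M / (1 - w)) <= normc w ^+ M / (1 - normc w).
Proof.
move=> w1; rewrite normcM normcV normcX ler_wpM2l ?exprn_ge0 ?normc_ge0 //.
have h : 1 - normc w <= normc (1 - w).
  rewrite lerBlDr -[leLHS](@normc1 R) -[X in normc X](subrK w) le_normcD //.
by rewrite lef_pV2 // posrE ?subr_gt0 // (lt_le_trans _ h) ?subr_gt0.
Qed.

(** The pairing with [c + 2 \sum_(k >= 1) (conj v)^k z^k], truncated at [M], equals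
    [2 c (B - a 0) - 2 \sum_(k >= 1) a k v^k]. *)
Lemma finite_harnack M a B (v : R[i]) :
  normc v < 1 ->
  (forall z, normc z = 1 -> Re (\sum_(n < M.+1) a n * z ^+ n) <= B) ->
  Re (\sum_(n < M.+1) a n * v ^+ n) <= Re (a 0) +
    (2 * normc v / (1 + normc v) + 2 * (normc v ^+ M.+1 / (1 - normc v)))
      * (B - Re (a 0)).
Proof.
move=> v1 aB; set r := normc v; set c := (X in _ <= _ + X * (B - _)).
(* The truncated Poisson kernel is at least [(1 - r) / (1 + r) - 2 r^(M+1) / (1 - r)]; adding
   [c - 1] raises this bound exactly to 0. *)
pose b k : R[i] := if k == 0%N then c%:C else 2 * (v^*%C) ^+ k.
have bge0 z : normc z = 1 -> 0 <= Re (\sum_(k < M.+1) b k * z ^+ k).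
  move=> z1; pose w := v^*%C * z.
  have wr : normc w = r by rewrite normcM z1 mulr1 normc_conj.
  have w1 : 1 - w != 0.
    by rewrite subr_eq0 eq_sym; apply: contraTneq v1 => E;
      rewrite -/r -wr E normc1 ltxx.
  have -> : \sum_(k < M.+1) b k * z ^+ k =
      (c - 1)%:C + ((1 + w) / (1 - w) - 2%:C * (w ^+ M.+1 / (1 - w))).
    have -> : \sum_(k < M.+1) b k * z ^+ k =
        c%:C - 2 + 2 * \sum_(k < M.+1) w ^+ k.
      rewrite !big_ord_recl /= /b /= !expr0 mulr1 mulrDr mulr1 addrA subrK.
      congr (_ + _); rewrite mulr_sumr; apply: eq_bigr => k _.
      by rewrite exprMn /bump /= -mulrA.
    have -> : \sum_(k < M.+1) w ^+ k = (1 - w ^+ M.+1) / (1 - w).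
      apply: (mulIf w1); rewrite mulfVK // -[RHS]opprB subrX1.
      by rewrite -[RHS]mulNr opprB mulrC.
    rewrite rmorphB rmorph1 rmorph_nat; field.
    by [].
  have wlt1 : normc w < 1 by rewrite wr.
  have := poisson_kernel_ge wlt1; rewrite wr => h1.
  have := normc_geometric_tail M.+1 wlt1; rewrite wr => h2.
  have := le_trans (norm_Re_le_normc _) h2; rewrite ler_norml => /andP[_ h3].
  rewrite !ReD ReN ReZ [Re (c - 1)%:C]/=.
  have : 2 * r / (1 + r) = 1 - (1 - r) / (1 + r).
    by have r0 : 0 <= r := normc_ge0 v; field; rewrite gt_eqF //; lra.
  move: h3 h1; rewrite /c -/r.
  by lra.
have bJ k : (b k.+1)^*%C = 2 * v ^+ k.+1.
  rewrite /b (rmorphM (@conjc R)) (rmorphXn (@conjc R)).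
  by congr (_ * _ ^+ _); [exact: conjc_nat | exact: conjcK].
have := circle_pairing_ge0 (gap_coef_ge0 aB) bge0.
rewrite !big_ord_recl expr0 mulr1.
under eq_bigr => k _.
  rewrite lift0 gap_coefS bJ.
  rewrite (_ : _ * _ = (- 2)%:C * (a k.+1 * v ^+ k.+1)); last first.
    by rewrite rmorphN rmorph_nat; ring.
  over.
under [X in _ -> Re (_ + X) <= _]eq_bigr => k _ do rewrite lift0.
have b0 : b 0 = c%:C by [].
rewrite -mulr_sumr gap_coef0 b0 conjc_real [_ * c%:C]mulrC.
rewrite !ReD !ReZ !ReD !ReN /=.
set S := Re _; set D := B - _; lra.
Qed.
End FiniteHarnack.

(** * Quaternion norm and convergence of quaternionic series *)

Section Quaternions.
Variable R : realType.
Implicit Types (p q : quat R) (a b : nat -> quat R) (z w : R[i]).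

Lemma quat_eq p q : qre p = qre q -> qi p = qi q -> qj p = qj q ->
  qk p = qk q -> p = q.
Proof. by case: p q => [? ? ? ?] [? ? ? ?] /= -> -> -> ->. Qed.

Lemma qnorm_ge0 q : 0 <= qnorm q.
Proof. exact: sqrtr_ge0. Qed.

Lemma sqr_qnorm q :
  qnorm q ^+ 2 = qre q ^+ 2 + qi q ^+ 2 + qj q ^+ 2 + qk q ^+ 2.
Proof. by rewrite sqr_sqrtr // !addr_ge0 ?sqr_ge0. Qed.

Lemma qnorm_le q (x : R) : 0 <= x ->
  (qnorm q <= x) = (qre q ^+ 2 + qi q ^+ 2 + qj q ^+ 2 + qk q ^+ 2 <= x ^+ 2).
Proof.
by move=> x0; rewrite -sqr_qnorm ler_pXn2r // nnegrE ?qnorm_ge0.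
Qed.

Lemma qnorm0 : qnorm (qzero R) = 0.
Proof. by rewrite /qnorm /= expr0n /= !addr0 sqrtr0. Qed.

Lemma qnorm1 : qnorm (qone R) = 1.
Proof. by rewrite /qnorm /= expr0n /= !addr0 expr1n sqrtr1. Qed.

(** After squaring, this is Euler's four-square identity. *)
Lemma qnormM p q : qnorm (qmul p q) = qnorm p * qnorm q.
Proof.
apply: (@pexpIrn _ 2); rewrite ?nnegrE ?mulr_ge0 ?qnorm_ge0 //.
rewrite exprMn !sqr_qnorm /=; ring.
Qed.

Lemma qnormX q n : qnorm (qpow q n) = qnorm q ^+ n.
Proof. by elim: n => [|n IH]; rewrite ?qnorm1 //= qnormM IH exprS. Qed.

Lemma qnormN q : qnorm (qopp q) = qnorm q.
Proof. by rewrite /qnorm /= !sqrrN. Qed.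

Lemma qnormZ (c : R) q : 0 <= c -> qnorm (qscale c q) = c * qnorm q.
Proof.
move=> c0; apply: (@pexpIrn _ 2); rewrite ?nnegrE ?mulr_ge0 ?qnorm_ge0 //.
rewrite exprMn !sqr_qnorm /=; ring.
Qed.

(** Cauchy-Schwarz, from Lagrange's identity: the difference of the squares is a sum of squared 2 by
    2 minors. *)
Lemma qdot_le p q :
  qre p * qre q + qi p * qi q + qj p * qj q + qk p * qk q <= qnorm p * qnorm q.
Proof.
set d := (X in X <= _); have [d0|d0] := ltP d 0.
  by rewrite (le_trans (ltW d0)) // mulr_ge0 ?qnorm_ge0.
rewrite -(@ler_pXn2r _ 2) ?nnegrE ?mulr_ge0 ?qnorm_ge0 //.
rewrite exprMn !sqr_qnorm /d -subr_ge0.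
case: p q {d d0} => [p0 p1 p2 p3] [q0 q1 q2 q3] /=.
have -> : (p0 ^+ 2 + p1 ^+ 2 + p2 ^+ 2 + p3 ^+ 2) *
    (q0 ^+ 2 + q1 ^+ 2 + q2 ^+ 2 + q3 ^+ 2) -
    (p0 * q0 + p1 * q1 + p2 * q2 + p3 * q3) ^+ 2 =
  (p0 * q1 - p1 * q0) ^+ 2 + (p0 * q2 - p2 * q0) ^+ 2 +
  (p0 * q3 - p3 * q0) ^+ 2 + (p1 * q2 - p2 * q1) ^+ 2 +
  (p1 * q3 - p3 * q1) ^+ 2 + (p2 * q3 - p3 * q2) ^+ 2 by ring.
by rewrite !addr_ge0 ?sqr_ge0.
Qed.

Lemma qnormD p q : qnorm (qadd p q) <= qnorm p + qnorm q.
Proof.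
rewrite qnorm_le ?addr_ge0 ?qnorm_ge0 // [leRHS]sqrrD !sqr_qnorm.
by have := qdot_le p q; move: (_ * qnorm _) => d /=; lra.
Qed.

Lemma qnormB p q : qnorm (qsub p q) <= qnorm p + qnorm q.
Proof. by rewrite -[X in _ + X]qnormN qnormD. Qed.

Lemma norm_qre_le q : `|qre q| <= qnorm q.
Proof. by rewrite -sqrtr_sqr ler_wsqrtr // -!addrA lerDl !addr_ge0 ?sqr_ge0. Qed.

Lemma norm_qi_le q : `|qi q| <= qnorm q.
Proof.
rewrite -sqrtr_sqr ler_wsqrtr // -subr_ge0.
have := (sqr_ge0 (qre q), sqr_ge0 (qj q), sqr_ge0 (qk q)) => -[[]] *; lra.
Qed.

Lemma norm_qj_le q : `|qj q| <= qnorm q.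
Proof.
rewrite -sqrtr_sqr ler_wsqrtr // -subr_ge0.
have := (sqr_ge0 (qre q), sqr_ge0 (qi q), sqr_ge0 (qk q)) => -[[]] *; lra.
Qed.

Lemma norm_qk_le q : `|qk q| <= qnorm q.
Proof. by rewrite -sqrtr_sqr ler_wsqrtr // lerDr !addr_ge0 ?sqr_ge0. Qed.

Lemma qnorm_le_sum q : qnorm q <= `|qre q| + `|qi q| + `|qj q| + `|qk q|.
Proof.
rewrite qnorm_le ?addr_ge0 //.
rewrite -[qre q ^+ 2]real_normK ?num_real // -[qi q ^+ 2]real_normK ?num_real //.
rewrite -[qj q ^+ 2]real_normK ?num_real // -[qk q ^+ 2]real_normK ?num_real //.
move: (normr_ge0 (qre q)) (normr_ge0 (qi q)) (normr_ge0 (qj q)) (normr_ge0 (qk q)).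
move: `|qre q| `|qi q| `|qj q| `|qk q| => x y z t x0 y0 z0 t0.
rewrite -subr_ge0 [leRHS](_ : _ = 2 * (x * y + x * z + x * t + y * z + y * t + z * t)).
  by rewrite mulr_ge0 // !addr_ge0 // mulr_ge0.
by ring.
Qed.

Lemma qpsumS a q N :
  qpsum a q N.+1 = qadd (qpsum a q N) (qmul (qpow q N) (a N)).
Proof.
rewrite /qpsum -addn1 iotaD add0n map_cat foldr_cat /=.
elim: [seq _ | m <- _] => [|x s IH] /=; last rewrite IH.
  by apply: quat_eq => /=; rewrite addr0 add0r.
by apply: quat_eq => /=; rewrite addrA.
Qed.

Lemma qnorm_qterm a q n : qnorm (qmul (qpow q n) (a n)) = qnorm q ^+ n * qnorm (a n).
Proof. by rewrite qnormM qnormX. Qed.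

Lemma qpsum0S a N : qpsum a (qzero R) N.+1 = a 0.
Proof.
elim: N => [|N IH]; rewrite qpsumS ?IH; apply: quat_eq => /=; ring.
Qed.

Lemma qcvg_seriesE a q (l : quat R) : qcvg (qpsum a q) l -> qseries a q = l.
Proof. by case=> *; apply: quat_eq; apply: cvg_lim. Qed.

Lemma qseries0 a : qseries a (qzero R) = a 0.
Proof.
have cvt (g : quat R -> R) :
    ((fun N => g (qpsum a (qzero R) N)) @ \oo --> g (a 0))%classic.
  rewrite -cvg_shiftS (_ : (fun N => _) = fun=> g (a 0)); first exact: cvg_cst.
  by apply/funext => N; rewrite /= qpsum0S.
by apply: qcvg_seriesE; split; apply: cvt.
Qed.

(** Closed balls are closed under coordinatewise limits. The bound starts at index 1 because the
    empty partial sum lacks the constant term. *)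
Lemma qcvg_qsub_le (u : nat -> quat R) l p (B : R) :
  qcvg u l -> (forall N, qnorm (qsub (u N.+1) p) <= B) -> qnorm (qsub l p) <= B.
Proof.
move=> [c0 c1 c2 c3] uB.
have B0 : 0 <= B := le_trans (qnorm_ge0 _) (uB 0%N).
rewrite qnorm_le //=.
pose v N := qsub (u N) p.
apply: (@cvgr_to_le _ \oo%classic _ R (fun N => qre (v N) ^+ 2 + qi (v N) ^+ 2
  + qj (v N) ^+ 2 + qk (v N) ^+ 2)).
  rewrite /v /=; apply: cvgD; [apply: cvgD; [apply: cvgD|]|];
    by apply: cvgM; apply: cvgD => //; apply: cvg_cst.
exists 1%N => // -[//|N] _ /=.
by move: (uB N); rewrite qnorm_le.
Qed.

Lemma qcvg_bounded (u : nat -> quat R) l :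
  qcvg u l -> exists K, forall n, qnorm (u n) <= K.
Proof.
have bnd (v : nat -> R) (y : R) : (v @ \oo --> y)%classic ->
    exists K, forall n, `|v n| <= K.
  move=> vy; have : cvgn v by apply/cvg_ex; exists y.
  move=> /cvg_seq_bounded [K [_ /(_ (K + 1))]].
  by rewrite ltrDl ltr01 => /(_ isT) h; exists (K + 1) => n; apply: h.
move=> [/bnd[K0 h0] /bnd[K1 h1] /bnd[K2 h2] /bnd[K3 h3]].
exists (K0 + K1 + K2 + K3) => n; apply: le_trans (qnorm_le_sum _) _.
by rewrite !lerD.
Qed.

(** Each coordinate is additive and dominated by [qnorm], so its series converges by comparison.
    This makes the derivative series converge. *)
Lemma qcvg_series_normal a q (B : R) :
  (forall N, \sum_(m < N) qnorm q ^+ m * qnorm (a m) <= B) ->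
  qcvg (qpsum a q) (qseries a q).
Proof.
move=> aB; pose t m := qmul (qpow q m) (a m).
have cvt (g : quat R -> R) : g (qzero R) = 0 ->
    (forall x y, g (qadd x y) = g x + g y) -> (forall x, `|g x| <= qnorm x) ->
    cvgn (fun N => g (qpsum a q N)).
  move=> g0 gD gn.
  have -> : (fun N => g (qpsum a q N)) = series (fun m => g (t m)).
    apply/funext; elim=> [|N IH]; first by rewrite /series /= big_geq.
    by rewrite qpsumS gD IH seriesSr.
  apply: normed_cvg; apply: (@series_le_cvg _ _ (fun m => qnorm (t m))) => [n|n|n|].
  - exact: normr_ge0.
  - exact: qnorm_ge0.
  - exact: gn.
  apply: nondecreasing_is_cvgn.
    by apply: nondecreasing_series => *; apply: qnorm_ge0.
  exists B => _ [N _ <-]; rewrite /series /= big_mkord.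
  by under eq_bigr do rewrite qnorm_qterm; apply: aB.
split; apply: cvt => //; first exact: norm_qre_le; first exact: norm_qi_le.
- exact: norm_qj_le.
- exact: norm_qk_le.
Qed.

End Quaternions.

(** * From polynomials to power series on the circle *)

Section CirclePowerSeries.
Variable R : realType.
Variables (a : nat -> R[i]) (B K s : R) (l : R[i] -> R).
Hypotheses (s0 : 0 <= s) (s1 : s < 1).
Hypothesis aK : forall n, normc (a n) <= K * s ^+ n.
Hypothesis a_cvg : forall z, normc z = 1 ->
  ((fun N => Re (\sum_(n < N) a n * z ^+ n)) @ \oo --> l z)%classic.
Hypothesis lB : forall z, normc z = 1 -> l z <= B.

(** The sum of the majorant [K * s ^+ n] over [n >= M]: the truncation error on the unit circle. *)
Let tail M := K * s ^+ M / (1 - s).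

Let tail_cvg : (tail @ \oo --> (0 : R))%classic.
Proof.
rewrite (_ : tail = fun M => (K / (1 - s)) * s ^+ M); last first.
  by apply/funext => M; rewrite /tail mulrAC.
rewrite -[X in (_ --> X)%classic](mulr0 (K / (1 - s))).
by apply: cvgM; [exact: cvg_cst | apply: cvg_expr; rewrite ger0_norm].
Qed.

Lemma circle_partial_sum_le M z : normc z = 1 ->
  Re (\sum_(n < M) a n * z ^+ n) <= B + tail M.
Proof.
move=> z1; pose S N := Re (\sum_(n < N) a n * z ^+ n).
have K0 : 0 <= K by have := le_trans (normc_ge0 _) (aK 0); rewrite expr0 mulr1.
(* The exact geometric sum of [d] terms lets the induction close; [1 - s ^+ d <= 1] is used only
   afterwards. *)
have SM d : S M <= S (M + d)%N + K * s ^+ M * (1 - s ^+ d) / (1 - s).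
  elim: d => [|d IH]; first by rewrite addn0 expr0 subrr mulr0 mul0r addr0.
  apply: le_trans IH _; rewrite addnS {2}/S big_ord_recr /= ReD -/(S _) -addrA lerD2l.
  have := norm_Re_le_normc (a (M + d)%N * z ^+ (M + d)).
  rewrite normcM normcX z1 expr1n mulr1 => /le_trans/(_ (aK _)).
  rewrite ler_norml exprD => /andP[h _].
  have -> : K * s ^+ M * (1 - s ^+ d.+1) / (1 - s) =
      K * s ^+ M * (1 - s ^+ d) / (1 - s) + K * (s ^+ M * s ^+ d).
    by rewrite exprS; field; rewrite gt_eqF // subr_gt0.
  lra.
rewrite -lerBlDr; apply: le_trans (lB z1).
apply: (@cvgr_to_ge _ \oo%classic _ R S) (a_cvg z1) _.
exists M => // N /= MN; rewrite lerBlDr -(subnKC MN).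
apply: le_trans (SM (N - M)%N) _; rewrite lerD2l /tail.
rewrite ler_pM2r ?invr_gt0 ?subr_gt0 // ler_piMr ?mulr_ge0 ?exprn_ge0 //.
by rewrite gerBl exprn_ge0.
Qed.

Lemma circle_coef_le n : (0 < n)%N -> normc (a n) <= 2 * (B - Re (a 0)).
Proof.
move=> n0.
apply: (@cvgr_to_ge _ \oo%classic _ R (fun M => 2 * (B + tail M.+1 - Re (a 0)))).
  rewrite -[B in X in (_ --> X)%classic]addr0.
  apply: cvgM; first exact: cvg_cst.
  apply: cvgB; last exact: cvg_cst.
  by apply: cvgD; [exact: cvg_cst | rewrite cvg_shiftS].
exists n => // M /= nM; apply: (@finite_coef_le _ M); first by rewrite n0.
by move=> z z1; apply: circle_partial_sum_le.
Qed.

(** The truncated inequality holds with [B + tail M.+1] in place of [B]; both the tail and the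
    kernel error [r ^+ M.+1] vanish as [M] grows. *)
Lemma circle_harnack (v : R[i]) (y : R) : normc v < 1 ->
  ((fun N => Re (\sum_(n < N) a n * v ^+ n)) @ \oo --> y)%classic ->
  y <= Re (a 0) + 2 * normc v / (1 + normc v) * (B - Re (a 0)).
Proof.
move=> v1 vy; set r := normc v; rewrite -cvg_shiftS in vy.
pose U M := Re (a 0) + (2 * r / (1 + r) + 2 * (r ^+ M.+1 / (1 - r)))
      * (B + tail M.+1 - Re (a 0)).
apply: (ler_cvg_to vy) => /=; last first.
  near=> M; apply: (_ : _ <= U M); apply: finite_harnack => // z z1.
  exact: circle_partial_sum_le.
rewrite -[B in X in (_ --> X)%classic]addr0.
rewrite -[2 * r / (1 + r) in X in (_ --> X)%classic]addr0.
apply: cvgD; first exact: cvg_cst.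
apply: cvgM; last first.
  apply: cvgB; last exact: cvg_cst.
  by apply: cvgD; [exact: cvg_cst | rewrite cvg_shiftS].
apply: cvgD; first exact: cvg_cst.
rewrite -[0 in X in (_ --> X)%classic](mulr0 2).
apply: cvgM; first exact: cvg_cst.
rewrite -[0 in X in (_ --> X)%classic](mul0r (1 - r)^-1).
apply: cvgM; last exact: cvg_cst.
rewrite (cvg_shiftS (fun M => r ^+ M)).
by apply: cvg_expr; rewrite ger0_norm ?normc_ge0.
Unshelve. all: end_near.
Qed.

End CirclePowerSeries.

(** * Complex slices of the quaternions *)

Section Slices.
Variable R : realType.
Implicit Types (I p q : quat R) (z w : R[i]).

Definition imaginary_unit I := qi I ^+ 2 + qj I ^+ 2 + qk I ^+ 2 = 1.

Definition slice I z : quat R :=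
  Quat (Re z) (Im z * qi I) (Im z * qj I) (Im z * qk I).

(** For a unit [I], the orthogonal projection of [p] onto the slice of [I], read as a complex
    number. *)
Definition slice_coef I p : R[i] :=
  qre p +i* (qi I * qi p + qj I * qj p + qk I * qk p).

Lemma qre_mul_slice I z p : qre (qmul (slice I z) p) = Re (slice_coef I p * z).
Proof. by case: z => x y /=; ring. Qed.

Lemma qmul_slice I z w : imaginary_unit I ->
  qmul (slice I z) (slice I w) = slice I (z * w).
Proof.
move=> I1; case: z w => [x y] [x' y']; apply: quat_eq => /=; try ring.
transitivity (x * x' - y * y' * (qi I ^+ 2 + qj I ^+ 2 + qk I ^+ 2)); first ring.
by rewrite I1 mulr1.
Qed.

Lemma qpow_slice I z n : imaginary_unit I -> qpow (slice I z) n = slice I (z ^+ n).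
Proof.
move=> I1; elim: n => [|n IH]; first by apply: quat_eq => /=; rewrite ?mul0r.
rewrite exprS -qmul_slice // -IH //.
Qed.

Lemma qnorm_slice I z : imaginary_unit I -> qnorm (slice I z) = normc z.
Proof.
move=> I1; rewrite /qnorm; case: z => x y /=; congr Num.sqrt.
transitivity (x ^+ 2 + y ^+ 2 * (qi I ^+ 2 + qj I ^+ 2 + qk I ^+ 2)); first ring.
by rewrite I1 mulr1.
Qed.

Lemma slice_exists q : exists I z, imaginary_unit I /\ q = slice I z.
Proof.
case: q => x i j k; pose y := Num.sqrt (i ^+ 2 + j ^+ 2 + k ^+ 2).
have y2 : y ^+ 2 = i ^+ 2 + j ^+ 2 + k ^+ 2.
  by rewrite sqr_sqrtr // !addr_ge0 ?sqr_ge0.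
have [y0|y0] := eqVneq y 0.
  move/eqP: y2; rewrite y0 expr0n /= eq_sym.
  rewrite !paddr_eq0 ?addr_ge0 ?sqr_ge0 // !sqrf_eq0.
  move=> /andP[/andP[/eqP-> /eqP->] /eqP->].
  (* A real quaternion lies in every slice; the unit i is chosen. *)
  exists (Quat 0 1 0 0), (x +i* 0); split.
    by rewrite /imaginary_unit /=; ring.
  by apply: quat_eq => /=; rewrite ?mul0r.
exists (Quat 0 (i / y) (j / y) (k / y)), (x +i* y); split.
  by rewrite /imaginary_unit /= !exprMn -!mulrDl -y2 -exprMn mulfV // expr1n.
by apply: quat_eq => //=; rewrite mulrC divfK.
Qed.

Lemma slice_coefK I z : imaginary_unit I -> slice_coef I (slice I z) = z.
Proof.
move=> I1; case: z => x y; congr (_ +i* _) => /=.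
transitivity (y * (qi I ^+ 2 + qj I ^+ 2 + qk I ^+ 2)); first ring.
by rewrite I1 mulr1.
Qed.

(** Cauchy-Schwarz for [I] and the imaginary part of [p], again by Lagrange's identity. *)
Lemma normc_slice_coef_le I p : imaginary_unit I ->
  normc (slice_coef I p) <= qnorm p.
Proof.
move=> I1; rewrite ler_wsqrtr // -!addrA lerD2l addrA -subr_ge0.
rewrite -[X in _ <= X - _]mul1r -I1.
case: p I {I1} => [x i j k] [x' i' j' k'] /=.
rewrite [leRHS](_ : _ = (i' * j - j' * i) ^+ 2 + (i' * k - k' * i) ^+ 2
    + (j' * k - k' * j) ^+ 2); first by rewrite !addr_ge0 ?sqr_ge0.
by ring.
Qed.

Lemma qre_qpsum_slice (a : nat -> quat R) I z N : imaginary_unit I ->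
  qre (qpsum a (slice I z) N) = Re (\sum_(n < N) slice_coef I (a n) * z ^+ n).
Proof.
move=> I1; elim: N => [|N IH]; first by rewrite big_ord0.
by rewrite qpsumS big_ord_recr ReD -IH /= qpow_slice // -qre_mul_slice.
Qed.

(** Convergence at a real point [t] between [rho] and 1 bounds the terms [t^n |a n|], leaving the
    ratio [rho / t < 1]. *)
Lemma qcoef_decay (a : nat -> quat R) (rho : R) :
  (forall q, qnorm q < 1 -> qcvg (qpsum a q) (qseries a q)) ->
  0 <= rho < 1 ->
  exists K s, [/\ 0 <= s, s < 1 & forall n, rho ^+ n * qnorm (a n) <= K * s ^+ n].
Proof.
move=> acvg /andP[rho0 rho1]; pose t := (1 + rho) / 2.
have t0 : 0 < t by rewrite /t; lra.
have tq : qnorm (Quat t 0 0 0) = t.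
  by rewrite /qnorm /= expr0n /= !addr0 sqrtr_sqr gtr0_norm.
have /acvg/qcvg_bounded [K Kb] : qnorm (Quat t 0 0 0) < 1 by rewrite tq /t; lra.
(* [K] bounds the partial sums, and a term is the difference of two of them. *)
exists (K + K), (rho / t); split; first by rewrite divr_ge0 // ltW.
  by rewrite ltr_pdivrMr // mul1r /t; lra.
move=> n; have tn0 : t ^+ n != 0 by rewrite expf_neq0 ?gt_eqF.
have -> : rho ^+ n * qnorm (a n) = t ^+ n * qnorm (a n) * (rho / t) ^+ n.
  by rewrite [(rho / t) ^+ n]expr_div_n; field.
apply: ler_wpM2r; first by rewrite exprn_ge0 // divr_ge0 // ltW.
rewrite -[X in X ^+ n]tq -qnorm_qterm.
have -> : qmul (qpow (Quat t 0 0 0) n) (a n) =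
    qsub (qpsum a (Quat t 0 0 0) n.+1) (qpsum a (Quat t 0 0 0) n).
  by rewrite qpsumS; move: (qmul _ _) (qpsum _ _ _) => x y;
    apply: quat_eq => /=; ring.
by rewrite (le_trans (qnormB _ _)) // lerD.
Qed.
End Slices.

(** * Elementary real inequalities *)

Section RealEstimates.
Variable R : realFieldType.
Implicit Types (x y c r s t : R).

Lemma le_of_le_addM x y c : 0 <= c ->
  (forall t, 0 < t < 1 -> x <= y + c * t) -> x <= y.
Proof.
move=> c0 h; rewrite leNgt; apply/negP => yx.
(* This choice gives [c * t < x - y]; the summand [x - y] below keeps [t < 1], also when [c = 0]. *)
pose t := (x - y) / (2 * (c + (x - y))).
have d0 : 0 < 2 * (c + (x - y)) by lra.
have tE : t * (2 * (c + (x - y))) = x - y by rewrite divfK // gt_eqF.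
have t0 : 0 < t by rewrite divr_gt0 ?subr_gt0.
have t1 : t < 1 by rewrite ltr_pdivrMr //; lra.
have := h t; rewrite t0 t1 => /(_ isT).
nra.
Qed.

Lemma bernoulli_le n t : 0 <= t <= 1 -> 1 - n%:R * t <= (1 - t) ^+ n.
Proof.
move=> /andP[t0 t1]; elim: n => [|n IH]; first by rewrite mul0r subr0.
rewrite exprS -natr1; have := ler0n R n; nra.
Qed.

(** Partial sums of the negative binomial series. Pascal's rule gives
    [T n.+1 N.+1 = s * T n.+1 N + T n N.+1]; monotonicity in [N] then yields
    [(1 - s) * T n.+1 N.+1 <= T n N.+1]. *)
Lemma sum_negbin_le n N s : 0 <= s < 1 ->
  \sum_(k < N) 'C(k + n, n)%:R * s ^+ k <= ((1 - s) ^+ n.+1)^-1.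
Proof.
move=> /andP[s0 s1]; have d0 : 0 < 1 - s by rewrite subr_gt0.
pose T n N := \sum_(k < N) 'C(k + n, n)%:R * s ^+ k.
have TS m M : T m M <= T m M.+1.
  by rewrite /T big_ord_recr lerDl mulr_ge0 // exprn_ge0.
rewrite -/(T n N); elim: n N => [|n IH] N.
  rewrite expr1 -[leRHS]mul1r ler_pdivlMr // /T.
  under eq_bigr do rewrite bin0 mul1r.
  by rewrite mulrC -[1 - s]opprB mulNr -subrX1 opprB gerBl exprn_ge0.
have TP : T n.+1 N.+1 = s * T n.+1 N + T n N.+1.
  rewrite /T !big_ord_recl /= !add0n !binn !expr0 addrCA; congr (_ + _).
  rewrite mulr_sumr -big_split /=; apply: eq_bigr => k _.
  rewrite /bump /= add1n addnS binS addSnnS natrD exprS; ring.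
apply: le_trans (TS _ _) _.
rewrite exprS invfM mulrC ler_pdivlMr //.
apply: le_trans (IH N.+1); rewrite mulrBr mulr1 lerBlDr {1}TP addrC lerD2l.
by rewrite mulrC ler_wpM2r.
Qed.

End RealEstimates.

(** * The Borel-Caratheodory estimates *)

Section BorelCaratheodory.
Variable R : realType.
Variables (a : nat -> quat R) (A : R).
Hypothesis acvg : forall q, qnorm q < 1 -> qcvg (qpsum a q) (qseries a q).
Hypothesis aA : forall q, qnorm q < 1 -> qre (qseries a q) <= A.

Let c := A - qre (a 0).

Lemma gap_ge0 : 0 <= c.
Proof. by rewrite subr_ge0 -qseries0; apply: aA; rewrite qnorm0. Qed.

Definition dilated_coef I (rho : R) n : R[i] := (rho ^+ n)%:C * slice_coef I (a n).

Lemma sum_dilated_coef I rho z N :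
  \sum_(n < N) dilated_coef I rho n * z ^+ n =
  \sum_(n < N) slice_coef I (a n) * (rho%:C * z) ^+ n.
Proof.
apply: eq_bigr => n _; rewrite /dilated_coef exprMn rmorphXn mulrA.
by congr (_ * _); rewrite mulrC.
Qed.

(** Dilating by [rho] moves the unit circle inside the ball, which supplies the decay, convergence
    and upper bound that the circle estimates require. *)
Lemma dilated_circle I rho : imaginary_unit I -> 0 <= rho < 1 ->
  exists K s, [/\ 0 <= s, s < 1,
    forall n, normc (dilated_coef I rho n) <= K * s ^+ n &
    forall z, normc z = 1 ->
      ((fun N => Re (\sum_(n < N) dilated_coef I rho n * z ^+ n)) @ \oo
        --> qre (qseries a (slice I (rho%:C * z))))%classic /\
      qre (qseries a (slice I (rho%:C * z))) <= A].
Proof.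
move=> I1 rho01; have /andP[rho0 rho1] := rho01.
have [K [s [s0 s1 Ks]]] := qcoef_decay acvg rho01.
exists K, s; split=> // [n|z z1].
  rewrite normcM normc_real ger0_norm ?exprn_ge0 //.
  apply: le_trans (Ks n); rewrite ler_wpM2l ?exprn_ge0 //.
  exact: normc_slice_coef_le.
have q1 : qnorm (slice I (rho%:C * z)) < 1.
  by rewrite qnorm_slice // normcM normc_real z1 mulr1 ger0_norm.
split; last exact: aA.
have [cv _ _ _] := acvg q1.
under eq_fun do rewrite sum_dilated_coef -qre_qpsum_slice //.
exact: cv.
Qed.

Lemma dilated_coef0 I rho : Re (dilated_coef I rho 0) = qre (a 0).
Proof. by rewrite /dilated_coef ReZ mul1r. Qed.

Lemma qcoef_le n : (0 < n)%N -> qnorm (a n) <= 2 * c.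
Proof.
move=> n0; have [I [z [I1 anE]]] := slice_exists (a n).
have -> : qnorm (a n) = normc (slice_coef I (a n)).
  by rewrite anE slice_coefK // qnorm_slice.
set x := normc _; have x0 : 0 <= x := normc_ge0 _.
(* With [rho = 1 - t] the circle bound reads [rho^n x <= 2 c], and Bernoulli's inequality costs at
   most [n t x]. *)
apply: (@le_of_le_addM _ _ _ (n%:R * x)) => [|t /andP[t0 t1]].
  by rewrite mulr_ge0.
have rho01 : 0 <= 1 - t < 1 by apply/andP; split; lra.
have [K [s [s0 s1 aK acv]]] := dilated_circle I1 rho01.
have := circle_coef_le s0 s1 aK (fun z z1 => (acv z z1).1)
  (fun z z1 => (acv z z1).2) n0.
rewrite dilated_coef0 -/c normcM normc_real ger0_norm; last first.
  by apply: exprn_ge0; lra.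
rewrite -/x => h.
have : 1 - n%:R * t <= (1 - t) ^+ n by rewrite bernoulli_le // !ltW.
move: (_ ^+ n) (n%:R : R) h => u m h1 h2; nra.
Qed.

Lemma qre_series_le r q : qnorm q <= r -> r < 1 ->
  qre (qseries a q) <= qre (a 0) + 2 * r / (1 + r) * c.
Proof.
have [I [z [I1 ->]]] := slice_exists q; rewrite qnorm_slice // => zr r1.
have c0 := gap_ge0; set s := normc z in zr *; have s0 : 0 <= s := normc_ge0 z.
have z1 : s < 1 := le_lt_trans zr r1.
(* Monotonicity reduces the claim to the actual modulus [s] of the point. *)
have mono : 2 * s / (1 + s) <= 2 * r / (1 + r).
  rewrite ler_pdivrMr; last lra.
  rewrite mulrAC ler_pdivlMr; last lra.
  by nra.
apply: (le_of_le_addM c0) => t /andP[t0 t1].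
(* This radius lies strictly between [s] and 1, so [z / rho] stays in the disc; the Harnack factor
   [2 s / (rho + s)] exceeds [2 s / (1 + s)] by at most [t]. *)
pose rho := 1 - t * (1 - s).
have srho : s < rho by rewrite /rho; nra.
have rho0 : 0 < rho := le_lt_trans s0 srho.
have rho1 : rho < 1 by rewrite /rho; nra.
have rho01 : 0 <= rho < 1 by rewrite ltW.
have [K [k [k0 k1 aK acv]]] := dilated_circle I1 rho01.
pose v := (rho^-1)%:C * z.
have vE : rho%:C * v = z by rewrite mulrA -rmorphM mulfV ?gt_eqF // mul1r.
have vn : normc v = s / rho.
  by rewrite normcM normc_real ger0_norm ?invr_ge0 ?ltW // mulrC.
have v1 : normc v < 1 by rewrite vn ltr_pdivrMr // mul1r.
have vcvg : ((fun N => Re (\sum_(n < N) dilated_coef I rho n * v ^+ n)) @ \oo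
    --> qre (qseries a (slice I z)))%classic.
  have [cv _ _ _] : qcvg (qpsum a (slice I z)) (qseries a (slice I z)).
    by apply: acvg; rewrite qnorm_slice.
  under eq_fun do rewrite sum_dilated_coef vE -qre_qpsum_slice //.
  exact: cv.
have := circle_harnack k0 k1 aK (fun z z1 => (acv z z1).1)
  (fun z z1 => (acv z z1).2) v1 vcvg.
rewrite dilated_coef0 -/c vn => /le_trans; apply.
rewrite -addrA lerD2l [c * t]mulrC -mulrDl ler_wpM2r //.
apply: (@le_trans _ _ (2 * s / (1 + s) + t)); last by rewrite lerD2r.
have -> : 2 * (s / rho) / (1 + s / rho) = 2 * s / (rho + s).
  by field; apply/andP; split; rewrite gt_eqF //; lra.
rewrite ler_pdivrMr; last lra.
rewrite -[X in _ + X](mulfK (_ : 1 + s != 0)); last by rewrite gt_eqF //; lra.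
rewrite -mulrDl mulrAC ler_pdivlMr; last lra.
rewrite /rho; nra.
Qed.

Lemma qseries_sub_le r q : qnorm q <= r -> r < 1 ->
  qnorm (qsub (qseries a q) (a 0)) <= 2 * r / (1 - r) * c.
Proof.
move=> qr r1; have r0 : 0 <= r := le_trans (qnorm_ge0 _) qr.
have c0 := gap_ge0.
have d0 : 0 < 1 - r by rewrite subr_gt0.
apply: (qcvg_qsub_le (acvg (le_lt_trans qr r1))) => N.
(* The middle term is [2 c (r + ... + r^N)], the sum of the coefficient bounds. *)
apply: (@le_trans _ _ (2 * c * (r * (1 - r ^+ N) / (1 - r)))); last first.
  rewrite -subr_ge0 (_ : _ - _ = 2 * c * r * r ^+ N / (1 - r)).
    by rewrite !mulr_ge0 ?exprn_ge0 // invr_ge0 ltW.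
  by field; rewrite gt_eqF.
elim: N => [|N IH].
  rewrite (_ : qsub _ _ = qzero R) ?qnorm0 ?expr0 ?subrr ?mulr0 ?mul0r ?mulr0 //.
  by rewrite qpsumS; apply: quat_eq => /=; ring.
rewrite qpsumS (_ : qsub _ _ = qadd (qsub (qpsum a q N.+1) (a 0))
    (qmul (qpow q N.+1) (a N.+1))); last first.
  by move: (qmul _ _) (qpsum _ _ _) => x y; apply: quat_eq => /=; ring.
apply: le_trans (qnormD _ _) _; apply: le_trans (lerD IH (lexx _)) _.
rewrite qnorm_qterm.
have h : qnorm q ^+ N.+1 * qnorm (a N.+1) <= r ^+ N.+1 * (2 * c).
  by rewrite ler_pM ?exprn_ge0 ?qnorm_ge0 ?qcoef_le // lerXn2r ?nnegrE ?qnorm_ge0.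
apply: le_trans (lerD (lexx _) h) _.
rewrite le_eqVlt; apply/orP; left; apply/eqP.
by rewrite [r ^+ N.+1]exprS; field; rewrite gt_eqF.
Qed.

(** The falling factorial is [n!] times a binomial coefficient, so the coefficient bounds add up to
    a negative binomial series. As [n > 0], only coefficients of positive index occur. *)
Lemma sderiv_le n r q : (0 < n)%N -> qnorm q <= r -> r < 1 ->
  qnorm (sderiv a n q) <= 2 * (n`!)%:R / (1 - r) ^+ n.+1 * c.
Proof.
move=> n0 qr r1; have r0 : 0 <= r := le_trans (qnorm_ge0 _) qr.
have c0 := gap_ge0; pose b := sderiv_coef a n.
set B := (X in _ <= X).
have bB N : \sum_(m < N) qnorm q ^+ m * qnorm (b m) <= B.
  apply: (@le_trans _ _ (\sum_(m < N) 2 * n`!%:R * c * ('C(m + n, n)%:R * r ^+ m))).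
    apply: ler_sum => m _; rewrite qnormZ // -bin_ffact natrM.
    have -> : 2 * n`!%:R * c * ('C(m + n, n)%:R * r ^+ m) =
      r ^+ m * ('C(m + n, n)%:R * n`!%:R * (2 * c)) by ring.
    rewrite ler_pM ?exprn_ge0 ?mulr_ge0 ?qnorm_ge0 //.
      by rewrite lerXn2r ?nnegrE ?qnorm_ge0.
    by rewrite ler_wpM2l ?mulr_ge0 // qcoef_le // addn_gt0 n0 orbT.
  rewrite -mulr_sumr.
  rewrite (_ : B = 2 * n`!%:R * c * ((1 - r) ^+ n.+1)^-1); last first.
    by rewrite /B mulrAC.
  by rewrite ler_wpM2l ?mulr_ge0 // sum_negbin_le // r0.
have subr0q x : qsub x (qzero R) = x.
  by apply: quat_eq; rewrite /= subr0.
rewrite -[sderiv _ _ _]subr0q.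
apply: (qcvg_qsub_le (qcvg_series_normal bB)) => N; rewrite subr0q.
apply: le_trans (bB N.+1); elim: (N.+1) => [|M IH].
  by rewrite big_ord0 qnorm0.
rewrite qpsumS big_ord_recr /=; apply: le_trans (qnormD _ _) _.
by rewrite qnorm_qterm lerD2r.
Qed.

End BorelCaratheodory.

Unset Implicit Arguments.

Theorem theorem1p4 (R : realType) (a : nat -> quat R) (A : R) :
  (* f(q) = sum q^n a_n converges on the open unit ball B *)
  (forall q : quat R, qnorm q < 1 -> qcvg (qpsum a q) (qseries a q)) ->
  (* A = sup_{q in B} Re f(q) < +oo *)
  (forall q : quat R, qnorm q < 1 -> qre (qseries a q) <= A) ->
  (forall A' : R, (forall q : quat R, qnorm q < 1 -> qre (qseries a q) <= A') ->
     A <= A') ->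
  let f := qseries a in
  let f0 := f (qzero R) in
  (forall n : nat, (1 <= n)%N -> qnorm (a n) <= 2 * (A - qre f0)) /\
  (forall (r : R) (q : quat R), qnorm q <= r -> r < 1 ->
     qnorm (qsub (f q) f0) <= (2 * r) / (1 - r) * (A - qre f0)) /\
  (forall (r : R) (q : quat R), qnorm q <= r -> r < 1 ->
     qre (f q) <= (2 * r) / (1 + r) * A + (1 - r) / (1 + r) * qre f0) /\
  (forall (n : nat) (r : R) (q : quat R), (1 <= n)%N -> qnorm q <= r -> r < 1 ->
     qnorm (sderiv a n q) <= 2 * (n`!)%:R / (1 - r) ^+ n.+1 * (A - qre f0)).
Proof.
move=> acvg aA _ f f0; rewrite /f0 /f qseries0.
split; first by move=> n n0; apply: qcoef_le.
split; first by move=> r q; apply: qseries_sub_le.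
split; last by move=> n r q; apply: sderiv_le.
move=> r q qr r1; apply: le_trans (qre_series_le acvg aA qr r1) _.
(* The two bounds coincide because [1 - 2 r / (1 + r) = (1 - r) / (1 + r)]. *)
rewrite le_eqVlt; apply/orP; left; apply/eqP.
have r0 : 0 <= r := le_trans (qnorm_ge0 q) qr.
by field; rewrite gt_eqF //; lra.
Qed.
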